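(* Let $f:A\longrightarrow C$ be a homomorphism of abelian groups. Then the fiber change maps $f_*:B^A(G)\longrightarrow B^C(G)$, for all finite groups $G$, define a morphism of inflation functors $B^A\to B^C$.
   Context: For a finite group $G$ and an abelian group $A$: a finite $A$-fibered $G$-set is a $G\times A$-set with finitely many orbits on which $A$ acts freely. $B^A(G)$ is the Grothendieck group (ring) of finite $A$-fibered $G$-sets with respect to disjoint union. It is the free abelian group on the isomorphism classes of transitive $A$-fibered $G$-sets; these correspond to $G$-orbits $[K,\phi]_G$ of pairs $(K,\phi)$, $K\le G$, $\phi\in\mathrm{Hom}(K,A)$, under the conjugation ${}^g(K,\phi)=(gKg^{-1},{}^g\phi)$, ${}^g\phi(x)=\phi(g^{-1}xg)$, where $[K,\phi]_G$ is the class of $(G\times A)/\{(k,\phi(k)) : k\in K\}$. Fiber change map: for a homomorphism $f:A\to C$, $f_*:B^A(G)\to B^C(G)$ is the additive map sending $[K,\phi]_G$ to $[K,f\circ\phi]_G$. Biset action: for a finite $(H,G)$-biset $U$ ($H,G$ finite groups) and an $A$-fibered $G$-set $X$, let $U\times_G X$ be the quotient of $U\times X$ by $(ug,x)\sim(u,gx)$, with its natural $H\times A$-action, and let $U\otimes_G X$ be the sub-$H\times A$-set of all elements having trivial stabilizer in $A$. This induces an additive map $B^A(U):B^A(G)\to B^A(H)$, additive in $U$ and functorial for composition of bisets. An inflation functor is an additive functor to abelian groups from the subcategory $\mathcal{C}^{\triangleright}$ of the biset category having all finite groups as objects and hom-sets generated by the classes of right-free bisets (finite $(H,G)$-bisets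 on which $G$ acts freely). The maps $f_*$ define a morphism of inflation functors when $f_*\circ B^A(U)=B^C(U)\circ f_*$ for all finite groups $G,H$ and all finite right-free $(H,G)$-bisets $U$. *)

(* Defs.v *)
From HB Require Import structures.
From mathcomp Require Import all_boot all_algebra all_fingroup.
From mathcomp Require Import boolp classical_sets functions cardinality fsbigop.
From mathcomp Require Import generic_quotient freeg.

Set Implicit Arguments.
Unset Strict Implicit.
Unset Printing Implicit Defensive.

Import GRing.Theory.
Local Open Scope ring_scope.
Local Open Scope quotient_scope.

Section GASets.
Variables (A : zmodType) (G : finGroupType).

(* [gact] is the action of the direct product of [G] (multiplicative) and [A]
   (additive), curried. *)
Record gaset := GASet {
  gaset_sort :> choiceType;
  gact : G -> A -> gaset_sort -> gaset_sort;
  gact1 : forall x, gact 1%g 0 x = x;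
  gactM : forall g h a b x, gact (g * h)%g (a + b) x = gact g a (gact h b x)
}.

Definition ga_orbit_rel (X : gaset) : rel X :=
  fun x y => `[< exists g a, y = gact g a x >].

Lemma gactK (X : gaset) g a : cancel (@gact X g a) (gact g^-1%g (- a)).
Proof. by move=> x; rewrite -gactM mulVg addNr gact1. Qed.

Lemma gactKV (X : gaset) g a : cancel (@gact X g^-1%g (- a)) (gact g a).
Proof. by move=> x; rewrite -gactM mulgV addrN gact1. Qed.

Lemma gactCA (X : gaset) g a b (x : X) :
  gact 1%g a (gact g b x) = gact g b (gact 1%g a x).
Proof. by rewrite -!gactM mul1g mulg1 addrC. Qed.

Lemma ga_orbit_refl (X : gaset) : reflexive (@ga_orbit_rel X).
Proof. by move=> x; apply/asboolP; exists 1%g, 0; rewrite gact1. Qed.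

Lemma ga_orbit_sym (X : gaset) : symmetric (@ga_orbit_rel X).
Proof.
move=> x y; apply/asboolP/asboolP => -[g [a ->]];
  by exists g^-1%g, (- a); rewrite gactK.
Qed.

Lemma ga_orbit_trans (X : gaset) : transitive (@ga_orbit_rel X).
Proof.
move=> y x z /asboolP[g [a ->]] /asboolP[h [b ->]].
by apply/asboolP; exists (h * g)%g, (b + a); rewrite gactM.
Qed.

Canonical ga_orbit_equiv (X : gaset) :=
  EquivRel (@ga_orbit_rel X) (@ga_orbit_refl X) (@ga_orbit_sym X)
    (@ga_orbit_trans X).

Definition ga_orbits (X : gaset) := {eq_quot (@ga_orbit_rel X)}.

HB.instance Definition _ (X : gaset) := Choice.on (ga_orbits X).
HB.instance Definition _ (X : gaset) := EqQuotient.on (ga_orbits X).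

Record fibered_set := FiberedSet {
  fibered_gaset :> gaset;
  fibered_fin : finite_set [set: ga_orbits fibered_gaset];
  fibered_free : forall a (x : fibered_gaset), gact 1%g a x = x -> a = 0
}.

Definition ga_iso (X Y : gaset) : Prop :=
  exists f : X -> Y,
    bijective f /\ forall g a x, f (gact g a x) = gact g a (f x).

Lemma ga_iso_inj_surj (X Y : gaset) (f : X -> Y) : injective f ->
  (forall y, exists x, f x = y) ->
  (forall g a x, f (gact g a x) = gact g a (f x)) -> ga_iso X Y.
Proof.
move=> fI fS fE; exists f; split=> //; exists (fun y => sval (cid (fS y))).
  by move=> x; apply: fI; exact: (svalP (cid (fS (f x)))).
by move=> y; exact: (svalP (cid (fS y))).
Qed.


Lemma ga_iso_sym (X Y : gaset) : ga_iso X Y -> ga_iso Y X.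
Proof.
move=> [f [[f' fK f'K] fE]]; exists f'; split; first by exists f.
by move=> g a y; rewrite -{1}[y]f'K -fE fK.
Qed.

Lemma ga_orbitsP (X : gaset) (x y : X) :
  reflect (exists g a, y = gact g a x) (\pi_(ga_orbits X) x == \pi y).
Proof.
apply: (iffP idP); first by rewrite piE => /asboolP.
by rewrite piE => ?; apply/asboolP.
Qed.

Lemma ga_finP (X : gaset) :
  (exists s : seq X, forall x, exists2 y, y \in s & exists g a, x = gact g a y)
  -> finite_set [set: ga_orbits X].
Proof.
case=> s sP; apply/finite_seqP; exists [seq \pi_(ga_orbits X) x | x <- s].
apply/seteqP; split=> // o _ /=.
have [y ys xy] := sP (repr o); apply/mapP; exists y => //.
by rewrite -[LHS]reprK; apply/esym/eqP/ga_orbitsP.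
Qed.

Lemma ga_finE (X : gaset) : finite_set [set: ga_orbits X] ->
  exists s : seq X, forall x, exists2 y, y \in s & exists g a, x = gact g a y.
Proof.
move=> /finite_seqP[s sE]; exists [seq repr o | o <- s] => x.
exists (repr (\pi_(ga_orbits X) x)).
  apply: map_f; have : [set: ga_orbits X]%classic (\pi x) by [].
  by rewrite sE.
by apply/ga_orbitsP; rewrite reprK.
Qed.

End GASets.

Section Constructions.
Variables (A : zmodType) (G : finGroupType).
Implicit Types X Y : gaset A G.

Section Sub.
Variables (X : gaset A G) (P : pred X).
Hypothesis PI : forall g a x, P x -> P (gact g a x).

Definition gasub_act g a (x : {x : X | P x}) : {x : X | P x} :=
  exist _ (gact g a (val x)) (PI g a (valP x)).

Lemma gasub_act1 x : gasub_act 1%g 0 x = x.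
Proof. by apply: val_inj; rewrite /= gact1. Qed.

Lemma gasub_actM g h a b x :
  gasub_act (g * h)%g (a + b) x = gasub_act g a (gasub_act h b x).
Proof. by apply: val_inj; rewrite /= gactM. Qed.

Definition gasub : gaset A G := GASet gasub_act1 gasub_actM.

Lemma gasub_fin :
  finite_set [set: ga_orbits X] -> finite_set [set: ga_orbits gasub].
Proof.
move=> /ga_finE[s sP]; apply: ga_finP.
exists (pmap insub s) => x; have [y ys [g [a xE]]] := sP (val x).
have Py : P y.
  have -> : y = gact g^-1%g (- a) (val x) by rewrite xE gactK.
  exact/PI/valP.
exists (Sub y Py : {x : X | P x}).
  by rewrite mem_pmap; apply/mapP; exists y => //; rewrite insubT.
by exists g, a; apply: val_inj; rewrite /= xE.
Qed.

End Sub.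

Section Sum.

Definition gasum_act X Y g a (z : X + Y) : X + Y :=
  match z with inl x => inl (gact g a x) | inr y => inr (gact g a y) end.

Lemma gasum_act1 X Y (z : X + Y) : gasum_act 1%g 0 z = z.
Proof. by case: z => z /=; rewrite gact1. Qed.

Lemma gasum_actM X Y g h a b (z : X + Y) :
  gasum_act (g * h)%g (a + b) z = gasum_act g a (gasum_act h b z).
Proof. by case: z => z /=; rewrite gactM. Qed.

Definition gasum X Y : gaset A G :=
  GASet (@gasum_act1 X Y) (@gasum_actM X Y).

Variables X Y : fibered_set A G.

Lemma gasum_fin : finite_set [set: ga_orbits (gasum X Y)].
Proof.
have [s sP] := ga_finE (fibered_fin X).
have [t tP] := ga_finE (fibered_fin Y).
apply: ga_finP; exists ([seq inl x | x <- s] ++ [seq inr y | y <- t]).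
case=> z; [have [y ys [g [a zE]]] := sP z | have [y ys [g [a zE]]] := tP z].
  by exists (inl y); rewrite ?mem_cat ?map_f//; exists g, a; rewrite /= zE.
exists (inr y); first by rewrite mem_cat map_f ?orbT.
by exists g, a; rewrite /= zE.
Qed.

Lemma gasum_free a (z : gasum X Y) : gact 1%g a z = z -> a = 0.
Proof. by case: z => z [/fibered_free]. Qed.

(* Disjoint union. *)
Definition fibered_sum : fibered_set A G := FiberedSet gasum_fin gasum_free.

End Sum.
End Constructions.

Section Pairs.
Variables (A : zmodType) (G : finGroupType).

(* A homomorphism from a subgroup [K] to [A] is encoded as a function on [G]
   that is additive on [K] and, so that equality is the right one, vanishes
   outside [K]. *)
Definition is_fpair (p : {group G} * {ffun G -> A}) : bool :=
  [forall x in p.1, forall y in p.1, p.2 (x * y)%g == p.2 x + p.2 y]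
  && [forall x, (x \notin p.1) ==> (p.2 x == 0)].

Record fpair := FPair {
  fpair_val :> {group G} * {ffun G -> A};
  _ : is_fpair fpair_val
}.

HB.instance Definition _ := [isSub for fpair_val].
HB.instance Definition _ := [Choice of fpair by <:].

Definition fgroup (p : fpair) : {group G} := (fpair_val p).1.
Definition fhom (p : fpair) (x : G) : A := (fpair_val p).2 x.

Lemma is_fpairP (p : {group G} * {ffun G -> A}) :
  reflect ({in p.1 &, forall x y, p.2 (x * y)%g = p.2 x + p.2 y} /\
           forall x, x \notin p.1 -> p.2 x = 0) (is_fpair p).
Proof.
apply: (iffP andP) => -[].
  move=> /forall_inP pM /forallP p0; split=> [x y Kx Ky|x Kx].
    exact/eqP/(forall_inP (pM x Kx)).
  exact/eqP/(implyP (p0 x)).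
move=> pM p0; split; last by apply/forallP => x; apply/implyP => /p0/eqP.
by apply/forall_inP => x Kx; apply/forall_inP => y Ky; apply/eqP/pM.
Qed.

Lemma fhomM p : {in fgroup p &, forall x y, fhom p (x * y)%g = fhom p x + fhom p y}.
Proof. by have /is_fpairP[] := valP p. Qed.

Lemma fhom_out p x : x \notin fgroup p -> fhom p x = 0.
Proof. by have /is_fpairP[_] := valP p; apply. Qed.

Lemma fhom1 p : fhom p 1%g = 0.
Proof.
have := fhomM (group1 (fgroup p)) (group1 (fgroup p)).
by rewrite mulg1 => /eqP; rewrite addrC -subr_eq subrr eq_sym => /eqP.
Qed.

Lemma fhomV p x : x \in fgroup p -> fhom p x^-1%g = - fhom p x.
Proof.
move=> Kx; apply/eqP; rewrite -addr_eq0 -fhomM ?groupV//.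
by rewrite mulVg fhom1.
Qed.

Lemma fpairP (p q : fpair) :
  fgroup p =i fgroup q -> fhom p =1 fhom q -> p = q.
Proof.
move=> pq1 pq2; apply: val_inj; case: p q pq1 pq2 => -[K f] pP [[L g] qP].
rewrite /fgroup /fhom /= => KL fg; congr (_, _); last exact/ffunP.
exact/val_inj/setP.
Qed.

(* [K :^ g^-1] is g K g^-1, and [x ^ g] is g^-1 x g. *)
Lemma fconj_subproof (g : G) (p : fpair) :
  is_fpair ((fgroup p :^ g^-1)%G, [ffun x => fhom p (x ^ g)%g]).
Proof.
apply/is_fpairP; split=> [x y Kx Ky|x Kx].
  by rewrite !ffunE conjMg fhomM// -mem_conjgV.
by rewrite ffunE fhom_out// -mem_conjgV.
Qed.

Definition fconj g p : fpair := FPair (fconj_subproof g p).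

Definition fconj_rel : rel fpair := fun p q => [exists g, q == fconj g p].

Lemma fgroup_conj g p x : (x \in fgroup (fconj g p)) = ((x ^ g)%g \in fgroup p).
Proof. exact: mem_conjgV. Qed.

Lemma fhom_conj g p x : fhom (fconj g p) x = fhom p (x ^ g)%g.
Proof. exact: ffunE. Qed.

Lemma fconj1 p : fconj 1%g p = p.
Proof.
by apply: fpairP => x; rewrite ?fgroup_conj ?fhom_conj conjg1.
Qed.

Lemma fconjM g h p : fconj (g * h)%g p = fconj g (fconj h p).
Proof.
by apply: fpairP => x; rewrite ?fgroup_conj ?fhom_conj conjgM.
Qed.

Lemma fconj_refl : reflexive fconj_rel.
Proof. by move=> p; apply/existsP; exists 1%g; rewrite fconj1. Qed.

Lemma fconj_sym : symmetric fconj_rel.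
Proof.
move=> p q; apply/existsP/existsP => -[g /eqP->];
  by exists g^-1%g; rewrite -fconjM mulVg fconj1.
Qed.

Lemma fconj_trans : transitive fconj_rel.
Proof.
move=> q p r /existsP[g /eqP->] /existsP[h /eqP->].
by apply/existsP; exists (h * g)%g; rewrite fconjM.
Qed.

Canonical fconj_equiv := EquivRel fconj_rel fconj_refl fconj_sym fconj_trans.

Definition fpair_orbit := {eq_quot fconj_rel}.

HB.instance Definition _ := Choice.on fpair_orbit.
HB.instance Definition _ := EqQuotient.on fpair_orbit.

Lemma fpair_orbitP (p q : fpair) :
  reflect (exists g, q = fconj g p) (\pi_fpair_orbit p == \pi q).
Proof.
rewrite piE; apply: (iffP existsP) => -[g]; first by move/eqP; exists g.
by move=> ->; exists g.
Qed.

End Pairs.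

Section Transitive.
Variables (A : zmodType) (G : finGroupType) (p : fpair A G).

(* The cosets of { (k, phi k) : k in K } in G x A. *)
Definition fcoset_rel : rel (G * A) := fun u v =>
  [exists k in fgroup p, v == ((u.1 * k)%g, u.2 + fhom p k)].

Lemma fcoset_refl : reflexive fcoset_rel.
Proof.
move=> [g a]; apply/exists_inP; exists 1%g => //=.
by rewrite fhom1 mulg1 addr0.
Qed.

Lemma fcoset_sym : symmetric fcoset_rel.
Proof.
have H u v : fcoset_rel u v -> fcoset_rel v u.
  move=> /exists_inP[k Kk /eqP->]; apply/exists_inP; exists k^-1%g => /=.
    by rewrite groupV.
  by rewrite fhomV// mulgK addrK; case: u.
by move=> u v; apply/idP/idP; apply: H.
Qed.

Lemma fcoset_trans : transitive fcoset_rel.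
Proof.
move=> v u w /exists_inP[k Kk /eqP->] /exists_inP[l Kl /eqP->].
apply/exists_inP; exists (k * l)%g; first by rewrite groupM.
by rewrite /= fhomM// mulgA addrA.
Qed.

Canonical fcoset_equiv := EquivRel fcoset_rel fcoset_refl fcoset_sym fcoset_trans.

Definition fcoset := {eq_quot fcoset_rel}.

HB.instance Definition _ := Choice.on fcoset.
HB.instance Definition _ := EqQuotient.on fcoset.

Lemma fcosetP (u v : G * A) :
  reflect (exists2 k, k \in fgroup p & v = ((u.1 * k)%g, u.2 + fhom p k))
          (\pi_fcoset u == \pi v).
Proof.
rewrite piE; apply: (iffP exists_inP) => -[k Kk]; last by move=> ->; exists k.
by move/eqP; exists k.
Qed.

Definition fcoset_act (g : G) (a : A) (c : fcoset) : fcoset :=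
  \pi_fcoset ((g * (repr c).1)%g, a + (repr c).2).

Lemma fcoset_actE g a u :
  fcoset_act g a (\pi u) = \pi_fcoset ((g * u.1)%g, a + u.2).
Proof.
apply/eqP; rewrite eq_sym /fcoset_act.
have /eqP/fcosetP[k Kk ->] : \pi_fcoset u = \pi_fcoset (repr (\pi_fcoset u)).
  by rewrite reprK.
by apply/fcosetP; exists k => //=; rewrite mulgA addrA.
Qed.

Lemma fcoset_act1 c : fcoset_act 1%g 0 c = c.
Proof. by elim/quotW: c => -[g a]; rewrite fcoset_actE mul1g add0r. Qed.

Lemma fcoset_actM g h a b c :
  fcoset_act (g * h)%g (a + b) c = fcoset_act g a (fcoset_act h b c).
Proof. by elim/quotW: c => u; rewrite !fcoset_actE /= mulgA addrA. Qed.

Definition fcoset_gaset : gaset A G := GASet fcoset_act1 fcoset_actM.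

Lemma fcoset_gactE g a u :
  @gact _ _ fcoset_gaset g a (\pi u) = \pi_fcoset ((g * u.1)%g, a + u.2).
Proof. exact: fcoset_actE. Qed.

Lemma fcoset_fin : finite_set [set: ga_orbits fcoset_gaset].
Proof.
apply: ga_finP; exists [:: \pi_fcoset (1%g, 0)] => x.
exists (\pi_fcoset (1%g, 0)); first by rewrite inE.
elim/quotW: x => -[g a]; exists g, a.
by rewrite fcoset_gactE /= mulg1 addr0.
Qed.

Lemma fcoset_free a (x : fcoset_gaset) : gact 1%g a x = x -> a = 0.
Proof.
elim/quotW: x => -[g b]; rewrite fcoset_gactE /= mul1g.
move=> /eqP/fcosetP[k Kk /= [gk]].
have -> : k = 1%g by apply: (mulgI g); rewrite mulg1 -gk.
by rewrite fhom1 addr0 -{1}[b]add0r => /addIr.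
Qed.

Definition fcosets : fibered_set A G := FiberedSet fcoset_fin fcoset_free.

Definition fcoset1 : fcosets := \pi_fcoset (1%g, 0).

Lemma fcoset1_act g a : gact g a fcoset1 = \pi_fcoset (g, a).
Proof. by rewrite fcoset_gactE /= mulg1 addr0. Qed.

End Transitive.

Section BurnsideGroup.
Variables (A : zmodType) (G : finGroupType).

(* B^A(G), as the free abelian group on the orbits [K, phi]_G.  It is not built
   as a quotient of the formal differences of fibered sets because these live
   in too large a universe for a [zmodType]; [fibered_class],
   [burnside_liftE] and [burnside_hom_ext] below exhibit it as the
   Grothendieck group of finite A-fibered G-sets. *)
Definition burnside := {freeg (fpair_orbit A G)}.

HB.instance Definition _ := GRing.Zmodule.on burnside.

Definition burnside_basis (o : fpair_orbit A G) : burnside :=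
  Freeg [:: (1, o)].

(* [K, phi]_G *)
Definition burnside_pair (p : fpair A G) : burnside := burnside_basis (\pi p).

(* Additive extension of a map given on the basis; [zmodule M] is [M] as a
   Z-module. *)
Definition burnside_ext (M : zmodType) (F : fpair_orbit A G -> M) :
  burnside -> M := fglift (F : _ -> zmodule M).

Lemma burnside_ext_is_additive (M : zmodType) (F : fpair_orbit A G -> M) :
  additive (burnside_ext F).
Proof. exact: (lift_is_additive (M := zmodule M)). Qed.

HB.instance Definition _ (M : zmodType) (F : fpair_orbit A G -> M) :=
  GRing.isAdditive.Build burnside M (burnside_ext F)
    (burnside_ext_is_additive F).

Lemma burnside_ext_basis (M : zmodType) (F : fpair_orbit A G -> M) o :
  burnside_ext F (burnside_basis o) = F o.
Proof. by rewrite /burnside_ext /burnside_basis liftU scale1r. Qed.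

Lemma burnside_ext_uniq (M : zmodType) (h1 h2 : {additive burnside -> M}) :
  (forall o, h1 (burnside_basis o) = h2 (burnside_basis o)) -> h1 =1 h2.
Proof.
move=> h12 D; rewrite -[D]freeg_sumE !raddf_sum; apply: eq_bigr => o _.
have -> : Freeg [:: (coeff o D, o)] = burnside_basis o *~ coeff o D.
  by rewrite /burnside_basis freegU_mulz intz.
by rewrite !raddfMz h12.
Qed.

End BurnsideGroup.

Section FiberedClass.
Variables (A : zmodType) (G : finGroupType).
Implicit Types X Y : fibered_set A G.

(* The stabilizer of [x] in G x A is { (k, phi k) : k in K } for a unique pair
   (K, phi). *)
Definition stab_set X (x : X) : {set G} :=
  finset (fun g : G => `[< exists a, gact g a x = x >]).

Definition stab_fun X (x : X) : {ffun G -> A} :=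
  [ffun g => xget 0 [set a | gact g a x = x]%classic].

Lemma stab_setP X (x : X) g :
  reflect (exists a, gact g a x = x) (g \in stab_set x).
Proof. by rewrite inE; apply: asboolP. Qed.

Lemma stab_set_group X (x : X) : group_set (stab_set x).
Proof.
apply/group_setP; split; first by apply/stab_setP; exists 0; rewrite gact1.
move=> g h /stab_setP[a xa] /stab_setP[b xb].
by apply/stab_setP; exists (a + b); rewrite gactM xb.
Qed.

Definition stab_group X (x : X) : {group G} := Group (stab_set_group x).

Lemma stab_uniq X (x : X) g a b : gact g a x = x -> gact g b x = x -> a = b.
Proof.
move=> xa xb; apply/eqP; rewrite -subr_eq0; apply/eqP.
apply: (@fibered_free _ _ X _ x).
by rewrite -{1}xb -gactM mul1g subrK.
Qed.

Lemma stab_funE X (x : X) g a : gact g a x = x -> stab_fun x g = a.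
Proof.
move=> xa; rewrite ffunE; case: xgetP => [b _ /= xb|/(_ a)//].
exact: stab_uniq xb xa.
Qed.

Lemma stab_is_fpair X (x : X) : is_fpair (stab_group x, stab_fun x).
Proof.
apply/is_fpairP; split=> /= [g h /stab_setP[a xa] /stab_setP[b xb]|g ng].
  rewrite (stab_funE xa) (stab_funE xb); apply: stab_funE.
  by rewrite gactM xb.
rewrite ffunE; case: xgetP => // a _ /= xa.
by case/negP: ng; apply/stab_setP; exists a.
Qed.

Definition stab_pair X (x : X) : fpair A G := FPair (stab_is_fpair x).

(* The class [X] is the sum, over the G x A-orbits of X, of the classes of the
   transitive fibered sets they form. *)
Definition fibered_class X : burnside A G :=
  \sum_(o \in [set: ga_orbits X]) burnside_pair (stab_pair (repr o)).

Lemma fgroup_stab X (x : X) g :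
  reflect (exists a, gact g a x = x) (g \in fgroup (stab_pair x)).
Proof. exact: stab_setP. Qed.

Lemma fhom_stabE X (x : X) g a : gact g a x = x -> fhom (stab_pair x) g = a.
Proof. exact: stab_funE. Qed.

Lemma stab_fhom X (x : X) g :
  g \in fgroup (stab_pair x) -> gact g (fhom (stab_pair x) g) x = x.
Proof. by move=> /fgroup_stab[a xa]; rewrite (fhom_stabE xa). Qed.

Lemma fpair_eqP (p q : fpair A G) :
  (forall g a, (g \in fgroup p /\ fhom p g = a) <->
               (g \in fgroup q /\ fhom q g = a)) -> p = q.
Proof.
move=> pq; have pq1 : fgroup p =i fgroup q.
  by move=> g; apply/idP/idP => Kg;
     [have [] := (pq g _).1 (conj Kg erefl) | have [] := (pq g _).2 (conj Kg erefl)].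
apply: fpairP => // g.
have [pg|pg] := boolP (g \in fgroup p).
  by have [_ ->] := (pq g _).1 (conj pg erefl).
by rewrite !fhom_out// -pq1.
Qed.

Lemma stab_pairP X (x : X) g a :
  (g \in fgroup (stab_pair x) /\ fhom (stab_pair x) g = a) <->
  gact g a x = x.
Proof.
split=> [[Kg <-]|xa]; first exact: stab_fhom.
by split; [apply/fgroup_stab; exists a | exact: fhom_stabE].
Qed.

Lemma stab_pair_inj X Y (x : X) (y : Y) :
  (forall g a, gact g a x = x <-> gact g a y = y) -> stab_pair x = stab_pair y.
Proof.
move=> xy; apply: fpair_eqP => g a.
by split=> /stab_pairP/xy/stab_pairP.
Qed.

Lemma stab_pair_act X (x : X) g a :
  stab_pair (gact g a x) = fconj g (stab_pair x).
Proof.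
apply: fpair_eqP => h b; rewrite fgroup_conj fhom_conj.
split=> [/stab_pairP|] H; last first.
  apply/stab_pairP; move/stab_pairP: H => H.
  rewrite -[in RHS]H -!gactM conjgE !mulgA mulgV mul1g.
  by rewrite [a + b]addrC.
apply/stab_pairP/(can_inj (gactK g a)).
rewrite -[RHS]H -!gactM conjgE !mulgA mulgV mul1g.
by rewrite [a + b]addrC.
Qed.

Lemma burnside_pair_conj g p : burnside_pair (fconj g p) = burnside_pair p :> burnside A G.
Proof.
congr burnside_basis; apply/esym/eqP/fpair_orbitP.
by exists g.
Qed.

Lemma burnside_pair_orbit X (x y : X) :
  \pi_(ga_orbits X) x = \pi_(ga_orbits X) y ->
  burnside_pair (stab_pair x) = burnside_pair (stab_pair y).
Proof.
move=> /eqP/ga_orbitsP[g [a ->]].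
by rewrite stab_pair_act burnside_pair_conj.
Qed.

Definition orbit_reps X (s : seq X) :=
  [/\ uniq s, {in s &, forall x y, (exists g a, y = gact g a x) -> x = y}
    & forall x, exists2 y, y \in s & exists g a, x = gact g a y].

Lemma orbit_repsP X (s : seq X) : orbit_reps s ->
  uniq [seq \pi_(ga_orbits X) x | x <- s] /\
  [set: ga_orbits X]%classic = [set` [seq \pi_(ga_orbits X) x | x <- s]]%classic.
Proof.
move=> [us sI sP]; split.
  rewrite map_inj_in_uniq// => x y xs ys /eqP/ga_orbitsP; exact: sI.
apply/seteqP; split=> // o _ /=.
have [y ys xy] := sP (repr o); apply/mapP; exists y => //.
by rewrite -[LHS]reprK; apply/esym/eqP/ga_orbitsP.
Qed.

Lemma orbit_reps_exists X : exists s : seq X, orbit_reps s.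
Proof.
have /finite_seqP[s sE] := fibered_fin X.
exists [seq repr o | o <- undup s]; split.
- by rewrite map_inj_uniq ?undup_uniq//; apply: (can_inj reprK).
- move=> _ _ /mapP[o _ ->] /mapP[o' _ ->] /ga_orbitsP/eqP.
  by rewrite !reprK => ->.
- move=> x; exists (repr (\pi_(ga_orbits X) x)).
    apply: map_f; rewrite mem_undup.
    have : [set: ga_orbits X]%classic (\pi x) by [].
    by rewrite sE.
  by apply/ga_orbitsP; rewrite reprK.
Qed.

Lemma fibered_class_reps X (s : seq X) : orbit_reps s ->
  fibered_class X = \sum_(x <- s) burnside_pair (stab_pair x).
Proof.
move=> /orbit_repsP[us sE]; rewrite /fibered_class sE -fsbig_seq// big_map.
by apply: eq_bigr => x _; apply: burnside_pair_orbit; rewrite reprK.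
Qed.

Lemma ga_inj_stab X Y (f : X -> Y) : injective f ->
  (forall g a x, f (gact g a x) = gact g a (f x)) ->
  forall x, stab_pair (f x) = stab_pair x.
Proof.
move=> fI fE x; apply: stab_pair_inj => g a.
by rewrite -fE; split=> [/fI|->].
Qed.

Lemma fibered_class_iso X Y : ga_iso X Y -> fibered_class X = fibered_class Y.
Proof.
move=> [f [fB fE]]; have fI := bij_inj fB.
have [s sR] := orbit_reps_exists X; have [us sI sP] := sR.
rewrite (fibered_class_reps sR) (@fibered_class_reps Y (map f s)).
  by rewrite big_map; apply: eq_bigr => x _; rewrite ga_inj_stab.
split; first by rewrite map_inj_uniq.
  move=> _ _ /mapP[x xs ->] /mapP[y ys ->] [g [a]]; rewrite -fE => /fI yx.
  by congr f; apply: sI => //; exists g, a.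
case: fB => f' fK f'K y; have [x xs [g [a yE]]] := sP (f' y).
by exists (f x); rewrite ?map_f//; exists g, a; rewrite -fE -yE f'K.
Qed.

Lemma fibered_class_sum X Y :
  fibered_class (fibered_sum X Y) = fibered_class X + fibered_class Y.
Proof.
have [s sR] := orbit_reps_exists X; have [us sI sP] := sR.
have [t tR] := orbit_reps_exists Y; have [ut tI tP] := tR.
rewrite (fibered_class_reps sR) (fibered_class_reps tR).
pose i1 (x : X) : fibered_sum X Y := inl x.
pose i2 (y : Y) : fibered_sum X Y := inr y.
have i1I : injective i1 by move=> ? ? [].
have i2I : injective i2 by move=> ? ? [].
rewrite (@fibered_class_reps (fibered_sum X Y) (map i1 s ++ map i2 t)).
  rewrite big_cat !big_map; congr (_ + _); apply: eq_bigr => z _.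
    by rewrite (ga_inj_stab i1I).
  by rewrite (ga_inj_stab i2I).
split.
- rewrite cat_uniq !map_inj_uniq// us ut /= andbT.
  by apply/hasPn => _ /mapP[y _ ->]; apply/negP => /mapP[].
- move=> u v; rewrite !mem_cat.
  move=> /orP[]/mapP[x xs ->] /orP[]/mapP[y ys ->] [g [a]] //= [yx].
    by congr i1; apply: sI => //; exists g, a.
  by congr i2; apply: tI => //; exists g, a.
- case=> z.
    have [x xs [g [a zE]]] := sP z; exists (i1 x).
      by rewrite mem_cat map_f.
    by exists g, a; rewrite zE.
  have [x xs [g [a zE]]] := tP z; exists (i2 x).
    by rewrite mem_cat map_f ?orbT.
  by exists g, a; rewrite zE.
Qed.

Lemma stab_fcosets p : stab_pair (fcoset1 p) = p.
Proof.
apply: fpair_eqP => h b; split=> [/stab_pairP|[Kh <-]].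
  rewrite fcoset1_act => /esym/eqP/fcosetP[k Kk /= [-> ->]].
  by rewrite mul1g add0r.
apply/stab_pairP; rewrite fcoset1_act.
by apply/esym/eqP/fcosetP; exists h => //=; rewrite mul1g add0r.
Qed.

Lemma fibered_class_fcosets p : fibered_class (fcosets p) = burnside_pair p.
Proof.
rewrite (@fibered_class_reps _ [:: fcoset1 p]); last first.
  split=> // [x y|x]; first by rewrite !inE => /eqP-> /eqP->.
  exists (fcoset1 p); first exact: mem_head.
  by elim/quotW: x => -[g a]; exists g, a; rewrite fcoset1_act.
by rewrite big_seq1 stab_fcosets.
Qed.

Lemma burnside_hom_ext (M : zmodType) (h1 h2 : {additive burnside A G -> M}) :
  (forall X, h1 (fibered_class X) = h2 (fibered_class X)) -> h1 =1 h2.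
Proof.
move=> h12; apply: burnside_ext_uniq => o; rewrite -[o]reprK.
by have := h12 (fcosets (repr o)); rewrite fibered_class_fcosets.
Qed.

(* The additive map induced by an additive invariant of fibered sets. *)
Definition burnside_lift (M : zmodType) (F : fibered_set A G -> M) :
  burnside A G -> M := burnside_ext (fun o => F (fcosets (repr o))).

HB.instance Definition _ (M : zmodType) (F : fibered_set A G -> M) :=
  GRing.Additive.on (burnside_lift F).

Section Lift.
Variables (M : zmodType) (F : fibered_set A G -> M).
Hypothesis F_iso : forall X Y, ga_iso X Y -> F X = F Y.
Hypothesis F_sum : forall X Y, F (fibered_sum X Y) = F X + F Y.

Lemma fcosets_stab X (x : X) (Y : gaset A G) (y : Y) :
  (forall g a, gact g a x = x <-> gact g a y = y) ->
  (forall z, exists g a, z = gact g a y) ->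
  ga_iso (fcosets (stab_pair x)) Y.
Proof.
move=> xy yP.
pose f (c : fcosets (stab_pair x)) : Y := gact (repr c).1 (repr c).2 y.
have fE u : f (\pi_(fcoset (stab_pair x)) u) = gact u.1 u.2 y.
  rewrite /f; have /eqP/fcosetP[k Kk ->] :
      \pi_(fcoset (stab_pair x)) u = \pi_(fcoset _) (repr (\pi_(fcoset (stab_pair x)) u)).
    by rewrite reprK.
  by rewrite /= gactM (xy _ _).1// stab_fhom.
apply: (@ga_iso_inj_surj _ _ _ _ f).
- elim/quotW=> -[g a]; elim/quotW=> -[h b]; rewrite !fE /= => gh.
  apply/eqP/fcosetP; exists (g^-1 * h)%g => /=.
    apply/fgroup_stab; exists (- a + b); apply/xy.
    by rewrite gactM -gh gactK.
  rewrite mulKVg; congr (_, _); rewrite (@fhom_stabE _ _ _ (- a + b)).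
    by rewrite addrA addrN add0r.
  by apply/xy; rewrite gactM -gh gactK.
- move=> z; have [g [a ->]] := yP z.
  by exists (\pi_(fcoset (stab_pair x)) (g, a)); rewrite fE.
- move=> g a; elim/quotW=> -[h b].
  by rewrite fcoset_gactE !fE /= gactM.
Qed.

Lemma ga_orbitE X g a (x : X) : \pi_(ga_orbits X) (gact g a x) = \pi x.
Proof. by apply/esym/eqP/ga_orbitsP; exists g, a. Qed.

Lemma orbits_inv X (P : pred (ga_orbits X)) g a (x : X) :
  P (\pi_(ga_orbits X) x) -> P (\pi_(ga_orbits X) (gact g a x)).
Proof. by rewrite ga_orbitE. Qed.

Definition orbits_sub X (P : pred (ga_orbits X)) : gaset A G :=
  gasub (@orbits_inv X P).

Lemma orbits_sub_free X P a (x : @orbits_sub X P) : gact 1%g a x = x -> a = 0.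
Proof. by move=> /(congr1 val)/fibered_free. Qed.

Definition orbits_fsub X (P : pred (ga_orbits X)) : fibered_set A G :=
  FiberedSet (gasub_fin (@orbits_inv X P) (fibered_fin X)) (@orbits_sub_free X P).

Lemma burnside_lift_pair p : burnside_lift F (burnside_pair p) = F (fcosets p).
Proof.
rewrite /burnside_lift /burnside_pair burnside_ext_basis.
have /eqP/fpair_orbitP[g pE] : \pi_(fpair_orbit A G) p = \pi_(fpair_orbit A G) (repr (\pi_(fpair_orbit A G) p)).
  by rewrite reprK.
apply: F_iso; rewrite pE.
rewrite -{1}[p]stab_fcosets -(stab_pair_act _ g 0).
apply: (fcosets_stab (y := gact g 0 (fcoset1 p))) => [//|z]; elim/quotW: z => -[h b].
by exists (h * g^-1)%g, b; rewrite -gactM mulgKV addr0 fcoset1_act.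
Qed.

Lemma lift0 Y : (Y -> False) -> F Y = 0.
Proof.
move=> Y0; apply: (addrI (F Y)); rewrite addr0 -F_sum; apply: F_iso.
pose f (z : fibered_sum Y Y) : Y := match z with inl y => y | inr y => y end.
apply: (@ga_iso_inj_surj _ _ _ _ f).
- by case=> y; case: (Y0 y).
- by move=> y; exists (inl y).
- by move=> g a [].
Qed.

Lemma orbits_fsub_sum X (s : seq (ga_orbits X)) : uniq s ->
  F (orbits_fsub (mem s)) = \sum_(o <- s) F (fcosets (stab_pair (repr o))).
Proof.
elim: s => [_|o s IHs /andP[os us]].
  by rewrite big_nil; apply: lift0 => -[x].
have po : pred1 o (\pi_(ga_orbits X) (repr o)) by rewrite /= reprK.
pose x0 : orbits_fsub (pred1 o) := Sub (repr o) po.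
have -> : F (orbits_fsub (mem (o :: s))) =
    F (orbits_fsub (pred1 o)) + F (orbits_fsub (mem s)); last first.
  rewrite big_cons IHs//; congr (_ + _); apply/F_iso/ga_iso_sym.
  apply: (fcosets_stab (y := x0)) => [g a|z].
    by split=> [?|/(congr1 val)//]; apply: val_inj.
  have /eqP := valP z; rewrite -[RHS]reprK => /esym/eqP/ga_orbitsP[g [a zE]].
  by exists g, a; apply: val_inj.
rewrite -F_sum; apply/F_iso/ga_iso_sym.
pose f (z : fibered_sum (orbits_fsub (pred1 o)) (orbits_fsub (mem s))) : X :=
  match z with inl x => val x | inr x => val x end.
have fP z : \pi_(ga_orbits X) (f z) \in o :: s.
  by case: z => -[z zP]; rewrite inE; apply/orP; [left|right].
apply: (@ga_iso_inj_surj _ _ _ _ (fun z => Sub (f z) (fP z) : orbits_fsub (mem (o :: s)))).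
- move=> y z /(congr1 val) /=; case: y z => [y|y] [z|z] /= => [/val_inj->//|yz|yz|/val_inj->//].
    have /eqP yo := valP y; have : \pi_(ga_orbits X) (val z) \in s := valP z.
    by rewrite -[val z]yz yo (negPf os).
  have /eqP zo := valP z; have : \pi_(ga_orbits X) (val y) \in s := valP y.
  by rewrite [val y]yz zo (negPf os).
- move=> [x /= xP]; have /orP[xo|xs] := xP.
    by exists (inl (Sub x xo)); apply: val_inj.
  by exists (inr (Sub x xs)); apply: val_inj.
- by move=> g a [] x; apply: val_inj.
Qed.

Lemma burnside_liftE X : burnside_lift F (fibered_class X) = F X.
Proof.
have /finite_seqP[s0 sE] := fibered_fin X.
have [s [us sT]] : exists s : seq (ga_orbits X), uniq s /\
    [set: ga_orbits X]%classic = [set` s]%classic.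
  by exists (undup s0); rewrite undup_uniq; split=> //; rewrite sE;
     apply/seteqP; split=> o /=; rewrite mem_undup.
rewrite /fibered_class sT -fsbig_seq// raddf_sum.
under eq_bigr do rewrite /= burnside_lift_pair.
rewrite -orbits_fsub_sum//; apply: F_iso.
pose f (z : orbits_fsub (mem s)) : X := val z.
apply: (@ga_iso_inj_surj _ _ _ _ f) => [y z /val_inj//||//].
move=> x; have xs : \pi_(ga_orbits X) x \in s.
  by have : [set: ga_orbits X]%classic (\pi x) by []; rewrite sT.
by exists (Sub x xs).
Qed.

End Lift.
End FiberedClass.

Record biset (H G : finGroupType) := Biset {
  biset_sort :> finType;
  blact : H -> biset_sort -> biset_sort;
  bract : biset_sort -> G -> biset_sort;
  blact1 : forall u, blact 1%g u = u;
  blactM : forall h k u, blact (h * k)%g u = blact h (blact k u);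
  bract1 : forall u, bract u 1%g = u;
  bractM : forall u g h, bract u (g * h)%g = bract (bract u g) h;
  blractA : forall h u g, blact h (bract u g) = bract (blact h u) g
}.

Definition right_free (H G : finGroupType) (U : biset H G) : Prop :=
  forall (u : U) (g : G), bract u g = u -> g = 1%g.

Section Tensor.
Variables (A : zmodType) (H G : finGroupType) (U : biset H G).

Section Balanced.
Variable X : gaset A G.

(* (u g, x) ~ (u, g x); as G is a group this is already an equivalence. *)
Definition bal_rel : rel (U * X) := fun p q =>
  [exists g, (p.1 == bract q.1 g) && (q.2 == gact g 0 p.2)].

Lemma bal_relP (p q : U * X) :
  reflect (exists g, p.1 = bract q.1 g /\ q.2 = gact g 0 p.2) (bal_rel p q).
Proof.
apply: (iffP existsP) => -[g]; first by move=> /andP[/eqP pq /eqP qp]; exists g.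
by move=> [pq qp]; exists g; rewrite pq qp !eqxx.
Qed.

Lemma bal_refl : reflexive bal_rel.
Proof. by move=> p; apply/bal_relP; exists 1%g; rewrite bract1 gact1. Qed.

Lemma bal_sym : symmetric bal_rel.
Proof.
have S p q : bal_rel p q -> bal_rel q p.
  move=> /bal_relP[g [pq qp]]; apply/bal_relP; exists g^-1%g.
  rewrite pq -bractM mulgV bract1; split=> //.
  by rewrite qp -gactM mulVg addr0 gact1.
by move=> p q; apply/idP/idP; apply: S.
Qed.

Lemma bal_trans : transitive bal_rel.
Proof.
move=> q p r /bal_relP[g [pq qp]] /bal_relP[h [qr rq]].
apply/bal_relP; exists (h * g)%g; rewrite pq qr bractM; split=> //.
by rewrite rq qp -gactM addr0.
Qed.

Canonical bal_equiv := EquivRel bal_rel bal_refl bal_sym bal_trans.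

Definition bal_prod := {eq_quot bal_rel}.

HB.instance Definition _ := Choice.on bal_prod.
HB.instance Definition _ := EqQuotient.on bal_prod.

Lemma bal_prodP (p q : U * X) :
  reflect (exists g, p.1 = bract q.1 g /\ q.2 = gact g 0 p.2)
          (\pi_bal_prod p == \pi q).
Proof. by rewrite piE; apply: bal_relP. Qed.

Definition bal_act (h : H) (a : A) (c : bal_prod) : bal_prod :=
  \pi_bal_prod (blact h (repr c).1, gact 1%g a (repr c).2).

Lemma bal_actE h a p :
  bal_act h a (\pi p) = \pi_bal_prod (blact h p.1, gact 1%g a p.2).
Proof.
rewrite /bal_act; apply/eqP/bal_prodP => /=.
have /eqP/bal_prodP[g [-> ->]] : \pi_bal_prod (repr (\pi_bal_prod p)) = \pi p.
  by rewrite reprK.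
by exists g; rewrite blractA gactCA.
Qed.

Lemma bal_act1 c : bal_act 1%g 0 c = c.
Proof. by elim/quotW: c => -[u x]; rewrite bal_actE /= blact1 gact1. Qed.

Lemma bal_actM h k a b c :
  bal_act (h * k)%g (a + b) c = bal_act h a (bal_act k b c).
Proof.
by elim/quotW: c => -[u x]; rewrite !bal_actE /= blactM -gactM mulg1.
Qed.

(* U x_G X *)
Definition bal_gaset : gaset A H := GASet bal_act1 bal_actM.

Lemma bal_gactE h a p :
  @gact _ _ bal_gaset h a (\pi_bal_prod p) =
  \pi_bal_prod (blact h p.1, gact 1%g a p.2).
Proof. exact: bal_actE. Qed.

Lemma bal_fin :
  finite_set [set: ga_orbits X] -> finite_set [set: ga_orbits bal_gaset].
Proof.
move=> /ga_finE[s sP]; apply: ga_finP.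
exists [seq \pi_bal_prod (u, x) | u <- enum U, x <- s] => c.
elim/quotW: c => -[u x]; have [y ys [g [a xE]]] := sP x.
exists (\pi_bal_prod (bract u g, y)).
  by apply/allpairsP; exists (bract u g, y); rewrite mem_enum.
exists 1%g, a; rewrite bal_gactE /= blact1.
apply/esym/eqP/bal_prodP; exists g; split=> //=.
by rewrite xE -gactM mulg1 add0r.
Qed.

Definition A_free (c : bal_gaset) : bool :=
  `[< forall a, gact 1%g a c = c -> a = 0 >].

Lemma A_free_act h b (c : bal_gaset) : A_free c -> A_free (gact h b c).
Proof.
move=> /asboolP c0; apply/asboolP => a.
by rewrite gactCA => /(can_inj (gactK h b))/c0.
Qed.

End Balanced.

Variable X : fibered_set A G.

Lemma tensor_free a (c : gasub (@A_free_act X)) : gact 1%g a c = c -> a = 0.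
Proof. by move=> /(congr1 val); have /asboolP := valP c; apply. Qed.

(* U (x)_G X: the elements of U x_G X having trivial stabilizer in A. *)
Definition tensor : fibered_set A H :=
  FiberedSet (gasub_fin (@A_free_act X) (bal_fin (fibered_fin X))) tensor_free.

End Tensor.

Section TensorTheory.
Variables (A : zmodType) (H G : finGroupType) (U : biset H G).
Implicit Types X Y Z : fibered_set A G.

Lemma bal_map_proof X Z (i : X -> Z) : injective i ->
  (forall g a x, i (gact g a x) = gact g a (i x)) ->
  exists j : bal_gaset U X -> bal_gaset U Z,
  [/\ injective j, forall h a c, j (gact h a c) = gact h a (j c)
    & forall u x, j (\pi_(bal_prod U X) (u, x)) = \pi_(bal_prod U Z) (u, i x)].
Proof.
move=> iI iE.
pose j (c : bal_gaset U X) : bal_gaset U Z :=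
  \pi_(bal_prod U Z) ((repr c).1, i (repr c).2).
have jE u x : j (\pi_(bal_prod U X) (u, x)) = \pi_(bal_prod U Z) (u, i x).
  rewrite /j; apply/eqP/bal_prodP.
  have /eqP/bal_prodP[g /= [-> xE]] :
      \pi_(bal_prod U X) (repr (\pi_(bal_prod U X) (u, x))) = \pi_(bal_prod U X) (u, x).
    by rewrite reprK.
  by exists g; rewrite /= -iE -xE.
exists j; split=> //.
  elim/quotW=> -[u x]; elim/quotW=> -[v y]; rewrite !jE.
  move=> /eqP/bal_prodP[g /= [-> yE]]; apply/eqP/bal_prodP; exists g.
  by split=> //=; apply: iI; rewrite iE.
by move=> h a; elim/quotW=> -[u x]; rewrite bal_gactE !jE bal_gactE /= iE.
Qed.

Lemma tensor_map X Z (i : X -> Z) : injective i ->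
  (forall g a x, i (gact g a x) = gact g a (i x)) ->
  exists j : tensor U X -> tensor U Z,
  [/\ injective j, forall h a c, j (gact h a c) = gact h a (j c),
      forall c u x, val c = \pi_(bal_prod U X) (u, x) ->
        val (j c) = \pi_(bal_prod U Z) (u, i x)
    & forall d u x, val d = \pi_(bal_prod U Z) (u, i x) -> exists c, j c = d].
Proof.
move=> iI iE; have [j [jI jE jpi]] := bal_map_proof iI iE.
have jF (c : bal_gaset U X) : A_free c = A_free (j c).
  apply/asboolP/asboolP => c0 a; first by rewrite -jE => /jI/c0.
  by move=> ca; apply: c0; rewrite -jE ca.
have jP (c : tensor U X) : A_free (j (val c)) by rewrite -jF; exact: valP c.
exists (fun c => Sub (j (val c)) (jP c)); split.
- by move=> c d /(congr1 val)/jI/val_inj.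
- by move=> h a c; apply: val_inj; rewrite /= jE.
- by move=> c u x /= ->.
- move=> d u x dE; have cP : A_free (\pi_(bal_prod U X) (u, x) : bal_gaset U X).
    by rewrite jF jpi -dE; exact: valP d.
  by exists (Sub (\pi_(bal_prod U X) (u, x) : bal_gaset U X) cP); apply: val_inj; rewrite /= jpi dE.
Qed.

Lemma tensor_iso X Y : ga_iso X Y -> ga_iso (tensor U X) (tensor U Y).
Proof.
move=> [f [[f' fK f'K] fE]]; have [j [jI jE _ jS]] := tensor_map (can_inj fK) fE.
apply: (ga_iso_inj_surj jI) => // d; have : exists p, \pi_(bal_prod U Y) p = val d.
  by exists (repr (val d)); rewrite reprK.
by move=> [[u y] dE]; apply: (jS d u (f' y)); rewrite f'K.
Qed.

Lemma tensor_sum X Y :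
  ga_iso (fibered_sum (tensor U X) (tensor U Y)) (tensor U (fibered_sum X Y)).
Proof.
pose i1 (x : X) : fibered_sum X Y := inl x.
pose i2 (y : Y) : fibered_sum X Y := inr y.
have i1I : injective i1 by move=> ? ? [].
have i2I : injective i2 by move=> ? ? [].
have [j1 [j1I j1E j1pi j1S]] := tensor_map i1I (fun _ _ _ => erefl).
have [j2 [j2I j2E j2pi j2S]] := tensor_map i2I (fun _ _ _ => erefl).
pose j (c : fibered_sum (tensor U X) (tensor U Y)) : tensor U (fibered_sum X Y) :=
  match c with inl c => j1 c | inr c => j2 c end.
have j12 c d : j1 c = j2 d -> False.
  have cE : val c = \pi_(bal_prod U X) ((repr (val c)).1, (repr (val c)).2).
    by rewrite -surjective_pairing reprK.
  have dE : val d = \pi_(bal_prod U Y) ((repr (val d)).1, (repr (val d)).2).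
    by rewrite -surjective_pairing reprK.
  by move=> /(congr1 val); rewrite (j1pi _ _ _ cE) (j2pi _ _ _ dE) =>
    /eqP/bal_prodP[g /= []].
apply: (@ga_iso_inj_surj _ _ _ _ j).
- by case=> c [] d /= => [/j1I->|/j12|/esym/j12|/j2I->].
- move=> d; have : exists p, \pi_(bal_prod U (fibered_sum X Y)) p = val d.
    by exists (repr (val d)); rewrite reprK.
  move=> [[u [x|y]] /esym dE].
    by have [c <-] := j1S _ _ _ dE; exists (inl c).
  by have [c <-] := j2S _ _ _ dE; exists (inr c).
- by move=> h a [] c; [apply: j1E | apply: j2E].
Qed.

(* B^A(U) *)
Definition biset_map : burnside A G -> burnside A H :=
  burnside_lift (fun X => fibered_class (tensor U X)).

HB.instance Definition _ := GRing.Additive.on biset_map.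

Lemma biset_mapE X : biset_map (fibered_class X) = fibered_class (tensor U X).
Proof.
apply: burnside_liftE => [Y Z YZ|Y Z]; first exact/fibered_class_iso/tensor_iso.
by rewrite -fibered_class_sum; apply/esym/fibered_class_iso/tensor_sum.
Qed.

End TensorTheory.

Section FiberChange.
Variables (A C : zmodType) (f : {additive A -> C}) (G : finGroupType).

Lemma fpair_map_subproof (p : fpair A G) :
  is_fpair (fgroup p, [ffun x => f (fhom p x)]).
Proof.
apply/is_fpairP; split=> [x y Kx Ky|x Kx]; rewrite !ffunE.
  by rewrite fhomM// raddfD.
by rewrite fhom_out// raddf0.
Qed.

(* (K, f \o phi) *)
Definition fpair_map (p : fpair A G) : fpair C G := FPair (fpair_map_subproof p).

Lemma fhom_map p x : fhom (fpair_map p) x = f (fhom p x).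
Proof. exact: ffunE. Qed.

(* f_*, sending [K, phi]_G to [K, f \o phi]_G. *)
Definition fiber_change : burnside A G -> burnside C G :=
  burnside_ext (fun o => burnside_pair (fpair_map (repr o))).

HB.instance Definition _ := GRing.Additive.on fiber_change.

Lemma fpair_map_conj g p : fpair_map (fconj g p) = fconj g (fpair_map p).
Proof.
apply: fpairP => x; first by rewrite [RHS]fgroup_conj; exact: (fgroup_conj g p).
by rewrite fhom_conj !fhom_map fhom_conj.
Qed.

Lemma fiber_changeE p :
  fiber_change (burnside_pair p) = burnside_pair (fpair_map p).
Proof.
rewrite /fiber_change /burnside_pair burnside_ext_basis.
have /eqP/fpair_orbitP[g ->] :
    \pi_(fpair_orbit A G) p =
    \pi_(fpair_orbit A G) (repr (\pi_(fpair_orbit A G) p)) by rewrite reprK.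
by rewrite fpair_map_conj; exact: burnside_pair_conj.
Qed.

End FiberChange.

(* The naturality condition making a family of additive maps B^A(G) -> B^C(G)
   a morphism of inflation functors: compatibility with the generators of the
   hom-sets of the category, the right-free bisets. *)
Definition inflation_morphism (A C : zmodType)
    (eta : forall G : finGroupType, {additive burnside A G -> burnside C G}) :=
  forall (G H : finGroupType) (U : biset H G), right_free U ->
  forall x : burnside A G, eta H (biset_map U x) = biset_map U (eta G x).

(* Main.v *)
Require Import Defs.
From mathcomp Require Import all_boot all_algebra all_fingroup.
From mathcomp Require Import boolp generic_quotient.
(* [gact] is the action of a [gaset] again, not that of the group library. *)
Import Defs.

(** A set-level description of [f_*] makes the naturality visible.  If [X] is
    an [A]-fibered [G]-set then [f_*[X]] is the class of [C x_A X], and this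
    [C]-fibered set is characterized by the map [X -> C x_A X]: it is
    equivariant along [f], and it induces a bijection from the [A]-orbits of
    [X] to the [C]-orbits of the target.  Call such maps fiber extensions.

    Because the target of a fiber extension is [C]-free, it sends orbit
    representatives to orbit representatives and turns the stabilizing pair
    [(K, phi)] of a point into [(K, f \o phi)].  Hence [f_*[X] = [Y]] whenever
    there is a fiber extension from [X] to [Y] ([fiber_change_class]).  The
    transitive set of [(K, phi)] extends to that of [(K, f \o phi)]
    ([fcosets_extension]), so every class on which the theorem has to be
    checked is covered by one example.

    Finally [U x_G -] preserves fiber extensions.  This alone does not give
    the theorem for an arbitrary biset, since the tensor product keeps only
    the points with trivial stabilizer in the fiber group, and a point whose
    stabilizer in [A] is nontrivial but lies in the kernel of [f] is discarded
    from the source while its image survives in the target.  For a right-free [U] the action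
    of the fiber group on [U x_G X] is free, nothing is discarded, and the
    extension passes to the tensor products ([tensor_extension]). *)

Set Implicit Arguments.
Unset Strict Implicit.
Unset Printing Implicit Defensive.

Import GRing.Theory.
Local Open Scope ring_scope.
Local Open Scope quotient_scope.

Section FiberExtension.
Variables (A C : zmodType) (f : {additive A -> C}).

(** The last two conditions are injectivity and surjectivity of the induced map
    [X / A -> Y / C], phrased on points to avoid forming these quotients. *)
Definition fiber_extension (G : finGroupType) (X : gaset A G) (Y : gaset C G)
    (i : X -> Y) : Prop :=
  [/\ forall g a x, i (gact g a x) = gact g (f a) (i x),
      forall c x y, i y = gact 1%g c (i x) -> exists a, y = gact 1%g a x
    & forall z, exists c x, z = gact 1%g c (i x)].

Section Class.
Variables (G : finGroupType) (X : fibered_set A G) (Y : fibered_set C G).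
Variable i : X -> Y.
Hypothesis iX : fiber_extension i.

(** The freeness of [C] on [Y] determines the fiber component: if [(g, c)]
    carries [i x] to [i y], then [c] has to be the image of the element of [A]
    that [g] needs to carry [x] to [y]. *)
Lemma extension_transporter g c x y : i y = gact g c (i x) ->
  exists2 a, c = f a & y = gact g a x.
Proof.
have [iE iI _] := iX; move=> iyx.
(* Separate the actions of [g] and [c], absorbing [g] into the source. *)
have iyg : i y = gact 1%g c (i (gact g 0 x)).
  by rewrite iE raddf0 -gactM mul1g addr0.
have [a ya] := iI _ _ _ iyg; exists a; last by rewrite ya -gactM mul1g addr0.
apply/eqP; rewrite -subr_eq0; apply/eqP.
apply: (@fibered_free _ _ Y _ (i y)).
rewrite {1}ya iE -gactM mul1g subrK.
exact/esym.
Qed.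

Lemma extension_stab x : stab_pair (i x) = fpair_map f (stab_pair x).
Proof.
have [iE _ _] := iX; apply: fpair_eqP => g c; rewrite fhom_map.
split=> [/stab_pairP/esym/extension_transporter[a -> xa]|[Kg <-]].
  by move/esym/stab_pairP: xa => [Kg <-].
by apply/stab_pairP; rewrite -iE stab_fhom.
Qed.

(** Both classes are sums over orbit representatives, and [i] carries those of
    [X] to those of [Y], so the sums agree term by term. *)
Lemma fiber_change_class :
  fiber_change f (fibered_class X) = fibered_class Y.
Proof.
have [iE iI iS] := iX; have [s sR] := orbit_reps_exists X.
have [us sI sP] := sR.
have siI : {in s &, injective i}.
  move=> x y xs ys ixy; apply: sI => //.
  have : i y = gact 1%g 0 (i x) by rewrite gact1.
  by move=> /extension_transporter[a _ ->]; exists 1%g, a.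
rewrite (fibered_class_reps sR) (@fibered_class_reps _ _ Y (map i s)).
  rewrite raddf_sum big_map; apply: eq_bigr => x _.
  by rewrite extension_stab; exact: fiber_changeE.
split; first by rewrite map_inj_in_uniq.
  move=> _ _ /mapP[x xs ->] /mapP[y ys ->] [g [c]].
  move=> /extension_transporter[a _ yx].
  by congr i; apply: sI => //; exists g, a.
move=> z; have [c [x ->]] := iS z; have [y ys [g [a ->]]] := sP x.
exists (i y); first exact: map_f.
by exists g, (c + f a); rewrite iE -gactM mul1g.
Qed.

End Class.

Lemma fcosets_extension (G : finGroupType) (p : fpair A G) :
  exists i : fcosets p -> fcosets (fpair_map f p), fiber_extension i.
Proof.
pose q := fpair_map f p.
pose i (z : fcosets p) : fcosets q :=
  \pi_(fcoset q) ((repr z).1, f (repr z).2).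
have iE u : i (\pi_(fcoset p) u) = \pi_(fcoset q) (u.1, f u.2).
  rewrite /i; apply/eqP; rewrite eq_sym.
  have /eqP/fcosetP[k Kk ->] :
      \pi_(fcoset p) u = \pi_(fcoset p) (repr (\pi_(fcoset p) u)).
    by rewrite reprK.
  by apply/fcosetP; exists k; rewrite //= fhom_map raddfD.
exists i; split.
- move=> g a; elim/quotW=> u.
  by rewrite fcoset_gactE !iE fcoset_gactE /= raddfD.
- move=> c; elim/quotW=> -[g a]; elim/quotW=> -[h b].
  rewrite !iE fcoset_gactE /= mul1g => /esym/eqP/fcosetP[k Kk /= [-> _]].
  exists (b - fhom p k - a); rewrite fcoset_actE /= mul1g subrK.
  by apply/esym/eqP/fcosetP; exists k; rewrite //= subrK.
- elim/quotW=> -[g c]; exists c, (\pi_(fcoset p) (g, 0)).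
  by rewrite iE fcoset_gactE /= mul1g raddf0 addr0.
Qed.

End FiberExtension.

(** If [a] fixes the class of [(u, x)], then some [g] fixes [u] and sends [x]
    to [a x]; right-freeness makes [g] trivial, and [A] is free on [X]. *)
Lemma right_free_A_free (A : zmodType) (H G : finGroupType) (U : biset H G)
    (X : fibered_set A G) (z : bal_gaset U X) : right_free U -> A_free z.
Proof.
move=> Ufree; apply/asboolP => a; elim/quotW: z => -[u x].
rewrite bal_gactE /= blact1 => /eqP/bal_prodP[g /= [/esym/Ufree-> xE]].
apply: (@fibered_free _ _ X _ (gact 1%g 0 x)).
by rewrite gact1 [RHS]xE gact1.
Qed.

Section Tensor.
Variables (A C : zmodType) (f : {additive A -> C}) (H G : finGroupType).
Variable U : biset H G.

(** The relation [(u g, x) ~ (u, g x)] involves only [G], with which [i]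
    commutes exactly, so points are glued in the same way on both sides. *)
Lemma bal_extension (X : gaset A G) (Y : gaset C G) (i : X -> Y) :
  fiber_extension f i ->
  exists j : bal_gaset U X -> bal_gaset U Y, fiber_extension f j.
Proof.
move=> [iE iI iS].
pose j (z : bal_gaset U X) : bal_gaset U Y :=
  \pi_(bal_prod U Y) ((repr z).1, i (repr z).2).
have jE u x : j (\pi_(bal_prod U X) (u, x)) = \pi_(bal_prod U Y) (u, i x).
  rewrite /j; apply/eqP/bal_prodP.
  have /eqP/bal_prodP[g /= [-> xE]] :
      \pi_(bal_prod U X) (repr (\pi_(bal_prod U X) (u, x))) =
      \pi_(bal_prod U X) (u, x) by rewrite reprK.
  by exists g; rewrite /= {1}xE iE raddf0.
exists j; split.
- move=> h a; elim/quotW=> -[u x].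
  by rewrite bal_gactE !jE bal_gactE /= iE.
- move=> c; elim/quotW=> -[u x]; elim/quotW=> -[v y].
  rewrite !jE bal_gactE /= blact1 => /eqP/bal_prodP[g /= [-> yx]].
  have : i (gact g 0 y) = gact 1%g c (i x) by rewrite iE raddf0 yx.
  move=> /iI[a ya]; exists a; rewrite bal_actE /= blact1.
  by apply/eqP/bal_prodP; exists g.
- elim/quotW=> -[u y]; have [c [x ->]] := iS y.
  exists c, (\pi_(bal_prod U X) (u, x)).
  by rewrite jE bal_gactE /= blact1.
Qed.

Lemma tensor_extension (X : fibered_set A G) (Y : fibered_set C G)
    (i : X -> Y) : right_free U -> fiber_extension f i ->
  exists j : tensor U X -> tensor U Y, fiber_extension f j.
Proof.
move=> Ufree /bal_extension[j [jE jI jS]].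
exists (fun z => Sub (j (val z)) (right_free_A_free (j (val z)) Ufree)); split.
- by move=> h a z; apply: val_inj; rewrite /= jE.
- move=> c z w /(congr1 val)/= /jI[a wz].
  by exists a; apply: val_inj.
- move=> z; have [c [w zE]] := jS (val z).
  exists c, (Sub w (right_free_A_free w Ufree)).
  exact: val_inj.
Qed.

End Tensor.

Theorem theorem4p6 (A C : zmodType) (f : {additive A -> C}) :
  inflation_morphism (fun G : finGroupType => fiber_change f (G := G)).
Proof.
(* Both sides are additive, so they may be compared on the basis. *)
move=> G H U Ufree x; pose fc K := @fiber_change A C f K.
rewrite -[LHS]/((fc H \o biset_map U) x) -[RHS]/((biset_map U \o fc G) x).
apply: burnside_ext_uniq x => o; rewrite -[o]reprK /=.
have [i iX] := fcosets_extension f (repr o).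
have [j jX] := tensor_extension Ufree iX.
rewrite -[burnside_basis _]/(burnside_pair (repr o)) -fibered_class_fcosets.
rewrite biset_mapE [LHS](fiber_change_class jX) -biset_mapE; congr biset_map.
exact/esym/(fiber_change_class iX).
Qed.
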